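(* Let $d_1,d_2,d_3$ be positive integers with $\gcd(d_1,d_2,d_3)=1$ and $3\le d_1<d_2<d_3\le d_1d_2-d_1-d_2$, such that none of them is a linear combination of the other two with non-negative integer coefficients, and let $S_3=\langle d_1,d_2,d_3\rangle$. Then the rescaled genus $h_0=K_0/g_3$ of $S_3$ satisfies $$\frac12\le h_0<\frac59 .$$
   Context: $S_3=\langle d_1,d_2,d_3\rangle$ is the numerical semigroup of all linear combinations of $d_1,d_2,d_3$ with non-negative integer coefficients. The set of gaps is $\Delta_3=\mathbb{Z}_{>0}\setminus S_3$, the genus is $G_0=\#\Delta_3$, and the Frobenius number $F_3$ is the largest element of $\Delta_3$. Put $\sigma_1=d_1+d_2+d_3$, $g_3=F_3+\sigma_1$, $\delta_1=(\sigma_1-1)/2$ and $K_0=G_0+\delta_1$. *)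

(* Defs.v *)
From mathcomp Require Import all_boot all_order all_algebra finmap.
From mathcomp Require Import all_classical.

Set Implicit Arguments.
Unset Strict Implicit.
Unset Printing Implicit Defensive.

Import Order.TTheory GRing.Theory Num.Theory.

Local Open Scope classical_set_scope.
Local Open Scope ring_scope.

Definition lincomb2 (x y : nat) : set nat :=
  [set n | exists a b : nat, n = (a * x + b * y)%N].

Definition semigroup3 (d1 d2 d3 : nat) : set nat :=
  [set n | exists a b c : nat, n = (a * d1 + b * d2 + c * d3)%N].

Definition gaps (d1 d2 d3 : nat) : set nat :=
  [set n | (0 < n)%N] `\` semigroup3 d1 d2 d3.

(* [fset_set A] is the finite set with the elements of [A] when [A] is finite,
   and is empty otherwise; [gaps] is finite when the generators are coprime, and
   nonempty when none of them is 1. *)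
Definition genus (d1 d2 d3 : nat) : nat := #|` fset_set (gaps d1 d2 d3)|.

Definition frobenius (d1 d2 d3 : nat) : nat :=
  (\max_(n <- fset_set (gaps d1 d2 d3)) n)%N.

Definition sigma1 (d1 d2 d3 : nat) : nat := (d1 + d2 + d3)%N.

Definition delta1 (d1 d2 d3 : nat) : rat := ((sigma1 d1 d2 d3)%:R - 1) / 2.

Definition K0 (d1 d2 d3 : nat) : rat :=
  (genus d1 d2 d3)%:R + delta1 d1 d2 d3.

Definition g3 (d1 d2 d3 : nat) : nat :=
  (frobenius d1 d2 d3 + sigma1 d1 d2 d3)%N.

Definition rescaled_genus (d1 d2 d3 : nat) : rat :=
  K0 d1 d2 d3 / (g3 d1 d2 d3)%:R.

(* Main.v *)
Require Import Defs.
From mathcomp Require Import all_boot all_order all_algebra finmap.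
From mathcomp Require Import boolp classical_sets functions cardinality.
From mathcomp Require Import zify ring lra.

(** Write n, u, v for the generators. Both K_0 and g_3 can be read off the
    Apery set of the semigroup with respect to n, the set of least elements
    of the semigroup in the residue classes modulo n. Such an element has the
    form i u + j v. When ties are broken consistently, the chosen pairs (i, j)
    form a down-set of the quadrant with exactly one point per residue class,
    and such a down-set is an L-shape: the union of the rectangles
    [0, b) x [0, q + c) and [b, b + p) x [0, c) ([apery_pair_Lshape]). Its two
    extreme corners come with relations
      (b + p) u = q v + alpha n   and   (q + c) v = p u + beta n,
    and everything becomes a polynomial in six natural numbers. With
      A = (alpha + beta) (p + b) (q + c),  P = alpha p c,  Q = beta b q,
    summing the weights i u + j v over the L-shape gives 2 K_0 = A + P + Q,
    and the two outer corners of the L-shape give g_3 >= A + P and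
    g_3 >= A + Q ([Lshape_parameters]). These hold also when some of the
    parameters vanish, so symmetric semigroups need no separate treatment.

    The upper bound 9 (2 K_0) < 10 g_3 thus reduces to
    9 min(P, Q) < A + max(P, Q). Expanding A gives P + Q and six further
    monomials, which fall into three pairs of product P Q; the arithmetic-
    geometric mean inequality bounds each pair below by 2 min(P, Q)
    ([nine_min_le]). As A > 0, equality forces alpha = beta, b = p and c = q;
    then n, u and v are all divisible by 3, which contradicts coprimality.

    The lower bound is the inequality F + 1 <= 2 G_0, which holds for every
    numerical semigroup with a gap: x and F - x cannot both belong to it
    ([frobenius_lt_2genus]). *)

Set Implicit Arguments.
Unset Strict Implicit.

Local Open Scope nat_scope.

(** * The Apery set as a down-set of pairs *)

Definition weight (u v i j : nat) : nat := i * u + j * v.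

(** Among the pairs whose weight lies in a given class modulo [n], one is
    selected: the weight is least and, among equal weights, [j] is least. The
    comparison is compatible with translations, which makes the selected pairs
    a down-set, and since [u > 0] the weight and [j] determine [i], which
    makes the selection unique. *)
Definition apery_pair (n u v i j : nat) : Prop :=
  forall i' j', weight u v i' j' = weight u v i j %[mod n] ->
  weight u v i j < weight u v i' j' \/
  weight u v i j = weight u v i' j' /\ j <= j'.

Lemma weightD u v i j x y :
  weight u v (i + x) (j + y) = weight u v i j + weight u v x y.
Proof. rewrite /weight; ring. Qed.

Lemma apery_pair_down n u v i j x y :
  apery_pair n u v (i + x) (j + y) -> apery_pair n u v i j.
Proof.
move=> ap i' j' e; have := ap (i' + x) (j' + y); rewrite !weightD => {}ap.
have /ap : weight u v i' j' + weight u v x y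
    = weight u v i j + weight u v x y %[mod n].
  by apply/eqP; rewrite eqn_modDr; apply/eqP.
lia.
Qed.

Lemma apery_pair_le n u v i j i' j' :
  apery_pair n u v i j -> i' <= i -> j' <= j -> apery_pair n u v i' j'.
Proof.
move=> ap le_i le_j; apply: (@apery_pair_down _ _ _ _ _ (i - i') (j - j')).
by rewrite !subnKC.
Qed.

Lemma apery_pair_uniq n u v i j i' j' : 0 < u ->
  apery_pair n u v i j -> apery_pair n u v i' j' ->
  weight u v i j = weight u v i' j' %[mod n] -> i = i' /\ j = j'.
Proof.
move=> u_gt0 ap ap' e.
have := ap i' j' (esym e); have := ap' i j e => h h'.
have ej : j = j' by lia.
have ew : weight u v i j = weight u v i' j' by lia.
split=> //; move: ew; rewrite ej /weight; nia.
Qed.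

Lemma apery_pair_exists n u v i j :
  exists i' j', apery_pair n u v i' j' /\
    weight u v i' j' = weight u v i j %[mod n].
Proof.
pose minimal_weight w := `[< exists i' j', weight u v i' j' = w /\
  w = weight u v i j %[mod n] >].
have ex_w : exists w, minimal_weight w.
  by exists (weight u v i j); apply/asboolP; exists i, j.
case: (ex_minnP ex_w) => w /asboolP[i0 [j0 [ew0 ew]]] min_w.
pose minimal_j j' := `[< exists i', weight u v i' j' = w >].
have ex_j : exists j', minimal_j j' by exists j0; apply/asboolP; exists i0.
case: (ex_minnP ex_j) => j1 /asboolP[i1 ew1] min_j.
exists i1, j1; split; last by rewrite ew1.
move=> i' j' e; rewrite ew1.
have le_w : w <= weight u v i' j'.
  by apply/min_w/asboolP; exists i', j'; split=> //; rewrite e ew1.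
case: (ltngtP w (weight u v i' j')) le_w => // [|eqw] _; first by left.
by right; split=> //; apply/min_j/asboolP; exists i'.
Qed.

(** * The L-shape *)

Definition Lshape (b c p q i j : nat) : bool :=
  (i < b) && (j < q + c) || (i < b + p) && (j < c).

Section ShapeOfAperySet.
Variables (n u v : nat).
Hypotheses (n_gt0 : 0 < n) (u_gt0 : 0 < u) (v_gt0 : 0 < v).

(** If the pair selected in the class of (i+1, j) had a positive first
    coordinate, then subtracting (1, 0) from both would give two selected pairs
    in one class, hence equal ones, and (i+1, j) itself would be selected. *)
Lemma corner_rep_x i j i' j' :
  apery_pair n u v i j -> ~ apery_pair n u v i.+1 j ->
  apery_pair n u v i' j' ->
  weight u v i' j' = weight u v i.+1 j %[mod n] -> i' = 0.
Proof.
case: i' => // i' ap nap ap'; rewrite -(addn1 i') -(addn1 i).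
rewrite -(addn0 j) -(addn0 j') !weightD => /eqP; rewrite eqn_modDr => /eqP e.
have ap1 : apery_pair n u v i' j' by apply: apery_pair_le ap' _ _.
by have [e1 e2] := apery_pair_uniq u_gt0 ap1 ap e; subst i' j'.
Qed.

Lemma corner_rep_y i j i' j' :
  apery_pair n u v i j -> ~ apery_pair n u v i j.+1 ->
  apery_pair n u v i' j' ->
  weight u v i' j' = weight u v i j.+1 %[mod n] -> j' = 0.
Proof.
case: j' => // j' ap nap ap'; rewrite -(addn1 j') -(addn1 j).
rewrite -(addn0 i) -(addn0 i') !weightD => /eqP; rewrite eqn_modDr => /eqP e.
have ap1 : apery_pair n u v i' j' by apply: apery_pair_le ap' _ _.
by have [e1 e2] := apery_pair_uniq u_gt0 ap1 ap e; subst i' j'.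
Qed.

Lemma apery_pair0 : apery_pair n u v 0 0.
Proof. by move=> i' j' _; rewrite /weight; nia. Qed.

Lemma not_apery_pair_x : ~ apery_pair n u v n 0.
Proof.
move=> /(_ 0 0); rewrite /weight !mul0n !addn0 mod0n modnMr => /(_ erefl); nia.
Qed.

Lemma not_apery_pair_y : ~ apery_pair n u v 0 n.
Proof.
move=> /(_ 0 0); rewrite /weight !mul0n !add0n mod0n modnMr => /(_ erefl); nia.
Qed.

Lemma apery_weight_le i j i' j' :
  apery_pair n u v i j -> weight u v i' j' = weight u v i j %[mod n] ->
  exists k, weight u v i' j' = weight u v i j + k * n.
Proof.
move=> ap e; have le_w : weight u v i j <= weight u v i' j'.
  by case: (ap _ _ e) => [/ltnW|[->]].
have /eqP := e; rewrite eqn_mod_dvd // => /dvdnP[k ek].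
by exists k; rewrite -ek subnKC.
Qed.

(** With (l, 0) and (0, h) the first pairs on the axes that are not selected,
    the pairs selected in their classes are (0, q) and (p, 0); here b = l - p
    and c = h - q. Adding the two relations shows that (b, c) lies in the class
    of 0, so nothing at or above it is selected. Conversely, a minimal pair
    (i, j) of the L-shape that is not selected would lie in the class of 0 with
    i, j > 0. Combining this with one of the two relations would then put two
    different pairs on the axes, (i + p, 0) and (0, h - j), or (0, j + q) and
    (l - i, 0), in one class although both are selected. *)
Lemma apery_pair_Lshape : exists b c p q alpha beta,
  [/\ 0 < b, 0 < c,
      (b + p) * u = q * v + alpha * n,
      (q + c) * v = p * u + beta * n
    & forall i j, apery_pair n u v i j <-> Lshape b c p q i j].
Proof.
have ex_l : exists l, ~~ `[< apery_pair n u v l 0 >].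
  by exists n; apply/asboolPn/not_apery_pair_x.
have ex_h : exists h, ~~ `[< apery_pair n u v 0 h >].
  by exists n; apply/asboolPn/not_apery_pair_y.
case: (ex_minnP ex_l) => l /asboolPn napl min_l.
case: (ex_minnP ex_h) => h /asboolPn naph min_h.
have apx i : i < l -> apery_pair n u v i 0.
  by move=> lt_i; apply: contrapT => /asboolPn /min_l; rewrite leqNgt lt_i.
have apy j : j < h -> apery_pair n u v 0 j.
  by move=> lt_j; apply: contrapT => /asboolPn /min_h; rewrite leqNgt lt_j.
have ltx i j : apery_pair n u v i j -> i < l.
  move=> ap; rewrite ltnNge; apply/negP => le_l.
  by apply: napl; apply: apery_pair_le ap le_l _.
have lty i j : apery_pair n u v i j -> j < h.
  move=> ap; rewrite ltnNge; apply/negP => le_h.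
  by apply: naph; apply: apery_pair_le ap _ le_h.
have l_gt0 : 0 < l := ltx _ _ apery_pair0.
have h_gt0 : 0 < h := lty _ _ apery_pair0.
have [p0 [q [ap_q eq_q]]] := apery_pair_exists n u v l 0.
have p0E : p0 = 0.
  have apl : apery_pair n u v l.-1 0 by apply: apx; lia.
  by apply: (corner_rep_x apl _ ap_q); rewrite prednK.
have [p [q0 [ap_p eq_p]]] := apery_pair_exists n u v 0 h.
have q0E : q0 = 0.
  have aph : apery_pair n u v 0 h.-1 by apply: apy; lia.
  by apply: (corner_rep_y aph _ ap_p); rewrite prednK.
subst p0 q0.
have lt_q := lty _ _ ap_q; have lt_p := ltx _ _ ap_p.
have [alpha ealpha] := apery_weight_le ap_q (esym eq_q).
have [beta ebeta] := apery_weight_le ap_p (esym eq_p).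
exists (l - p), (h - q), p, q, alpha, beta.
have le_p := ltnW lt_p; have le_q := ltnW lt_q.
rewrite !subnK // !subnKC //.
move: ealpha ebeta; rewrite /weight !mul0n !add0n !addn0 => ealpha ebeta.
split=> //; rewrite ?subn_gt0 // => i j.
rewrite /Lshape subnK // subnKC //; split.
  move=> ap; have lt_i := ltx _ _ ap; have lt_j := lty _ _ ap.
  rewrite lt_i lt_j andbT /= !ltnNge -negb_and; apply/negP => /andP[le_i le_j].
  have /apery_pair_uniq := apery_pair_le ap le_i le_j.
  have e : weight u v (l - p) (h - q) = weight u v 0 0 %[mod n].
    have -> : weight u v (l - p) (h - q) = (alpha + beta) * n.
      have := leq_mul le_p (leqnn u); have := leq_mul le_q (leqnn v).
      rewrite /weight !mulnBl mulnDl; lia.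
    by rewrite modnMl /weight !mul0n mod0n.
  by case/(_ 0 0 u_gt0 apery_pair0 e) => + _; lia.
(* Induction makes both lower neighbours of (i, j) selected pairs. *)
elim/ltn_ind: i j => i IHi; elim/ltn_ind => j IHj inL.
have [i0|i_gt0] := posnP i; first by subst i; apply: apy; lia.
have [j0|j_gt0] := posnP j; first by subst j; apply: apx; lia.
have apxm : apery_pair n u v i.-1 j by apply: IHi; lia.
have apym : apery_pair n u v i j.-1 by apply: IHj; lia.
apply: contrapT => nap.
have [i' [j' [ap' e']]] := apery_pair_exists n u v i j.
have i'0 : i' = 0.
  by apply: (corner_rep_x apxm _ ap'); rewrite prednK.
have j'0 : j' = 0.
  by apply: (corner_rep_y apym _ ap'); rewrite prednK.
subst i' j'.
have {}e' : weight u v i j = 0 %[mod n] by rewrite -e' /weight !mul0n.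
have lt_i : i < l by lia.
have lt_j : j < h by lia.
have /orP[lt_ip|lt_jq] : (i + p < l) || (j + q < h).
  by move: inL; clear; lia.
  have /apery_pair_uniq := apx _ lt_ip.
  case/(_ 0 (h - j) u_gt0) => [||/eqP].
  - by apply: apy; rewrite ltn_subrL j_gt0.
  - apply/eqP; rewrite -(eqn_modDr (j * v)).
    have -> : weight u v (i + p) 0 + j * v = weight u v i j + p * u.
      rewrite /weight; ring.
    have -> : weight u v 0 (h - j) + j * v = p * u + beta * n.
      by rewrite -ebeta /weight mul0n -mulnDl subnK // ltnW.
    by rewrite -modnDml e' mod0n add0n addnC modnMDl.
  by rewrite addn_eq0 eqn0Ngt i_gt0.
have /apery_pair_uniq := apy _ lt_jq.
case/(_ (l - i) 0 u_gt0) => [||_ /eqP].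
- by apply: apx; rewrite ltn_subrL i_gt0.
- apply/eqP; rewrite -(eqn_modDr (i * u)).
  have -> : weight u v 0 (j + q) + i * u = weight u v i j + q * v.
    rewrite /weight; ring.
  have -> : weight u v (l - i) 0 + i * u = q * v + alpha * n.
    by rewrite -ealpha /weight mul0n addn0 -mulnDl subnK // ltnW.
  by rewrite -modnDml e' mod0n add0n addnC modnMDl.
by rewrite addn_eq0 eqn0Ngt j_gt0.
Qed.

End ShapeOfAperySet.

(** * Sums of weights over the L-shape *)

Definition rect (i0 k m : nat) : seq (nat * nat) :=
  [seq (i, j) | i <- iota i0 k, j <- iota 0 m].

Lemma mem_rect i0 k m i j :
  ((i, j) \in rect i0 k m) = (i0 <= i < i0 + k) && (j < m).
Proof.
apply/allpairsP/idP => [[[x y] /= []]|/andP[ij jm]].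
  by rewrite !mem_iota add0n /= => ix jm [-> ->]; rewrite ix jm.
by exists (i, j); rewrite !mem_iota ij.
Qed.

Lemma rect_uniq i0 k m : uniq (rect i0 k m).
Proof.
by apply: allpairs_uniq => [||[? ?] [? ?] _ _ [-> ->]]; rewrite ?iota_uniq.
Qed.

Lemma size_rect i0 k m : size (rect i0 k m) = k * m.
Proof. by rewrite size_allpairs !size_iota. Qed.

Lemma sum_iota0 m : 2 * (\sum_(j <- iota 0 m) j) + m = m * m.
Proof.
elim: m => [|m IHm]; first by rewrite big_nil.
rewrite -(addn1 m) iotaD big_cat /= big_cons big_nil; lia.
Qed.

Lemma sum_rect u v i0 k m :
  2 * (\sum_(x <- rect i0 k m) weight u v x.1 x.2) + k * m * (u + v)
  = k * m * ((2 * i0 + k) * u + m * v).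
Proof.
rewrite big_allpairs_dep.
elim: k => [|k IHk]; first by rewrite big_nil.
rewrite -(addn1 k) iotaD big_cat /= big_cons big_nil addn0 mulnDr.
have inner : 2 * (\sum_(j <- iota 0 m) weight u v (i0 + k) j) + m * v
   = m * (2 * (i0 + k) * u + m * v).
  rewrite /weight big_split /= big_const_seq count_predT size_iota iter_addn_0.
  rewrite -big_distrl /=.
  have := sum_iota0 m; set s := (X in 2 * X + m = _) => es.
  transitivity (m * (2 * (i0 + k) * u) + (2 * s + m) * v); first by ring.
  rewrite es; ring.
move: IHk inner; set s := bigop _ _ _; set t := bigop _ _ _ => IHk inner.
transitivity (2 * s + k * m * (u + v) + (2 * t + m * v) + m * u); first by ring.
rewrite IHk inner; ring.
Qed.

Definition Lseq b c p q := rect 0 b (q + c) ++ rect b p c.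

Lemma mem_Lseq b c p q i j : ((i, j) \in Lseq b c p q) = Lshape b c p q i j.
Proof. rewrite mem_cat !mem_rect /Lshape; lia. Qed.

Lemma Lseq_uniq b c p q : uniq (Lseq b c p q).
Proof.
rewrite cat_uniq !rect_uniq andbT /=; apply/hasPn => -[i j].
rewrite /= !mem_rect; lia.
Qed.

(** * Gaps and the Apery set *)

Section CountingGaps.
Variables (n u v : nat).
Hypotheses (n_gt0 : 0 < n) (u_gt0 : 0 < u).
Hypothesis gcd_nuv : gcdn (gcdn n u) v = 1.

(** Bezout for (u, v) and then for (gcd(u, v), n); a negative coefficient of
    [v] is replaced by its product with 1 - n. *)
Lemma weight_onto r : exists i j, weight u v i j = r %[mod n].
Proof.
have [km kn ekm _] := egcdnP v u_gt0.
have g_gt0 : 0 < gcdn u v by rewrite gcdn_gt0 u_gt0.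
have [a b ea _] := egcdnP n g_gt0.
have gcd1 : gcdn (gcdn u v) n = 1 by rewrite gcdnC gcdnA.
rewrite gcd1 in ea.
exists (km * a * r), (n.-1 * kn * a * r).
have -> : weight u v (km * a * r) (n.-1 * kn * a * r)
    = (b * r + a * r * kn * v) * n + r.
  rewrite /weight -{2}(prednK n_gt0).
  transitivity (a * r * (km * u) + n.-1 * kn * a * r * v); first by ring.
  rewrite ekm.
  transitivity (r * (a * gcdn u v) + a * r * kn * v * n.-1.+1); first by ring.
  rewrite ea prednK //; ring.
by rewrite modnMDl.
Qed.

Definition apery_transversal (f : 'I_n -> nat * nat) : Prop :=
  forall r, apery_pair n u v (f r).1 (f r).2 /\
            weight u v (f r).1 (f r).2 %% n = r.

Lemma apery_transversal_exists : exists f, apery_transversal f.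
Proof.
suff reps : forall r : 'I_n, exists x : nat * nat,
    apery_pair n u v x.1 x.2 /\ weight u v x.1 x.2 %% n = r.
  by have [f fP] := choice reps; exists f.
move=> r; have [i [j e]] := weight_onto r.
have [i' [j' [ap e']]] := apery_pair_exists n u v i j.
by exists (i', j'); rewrite /= e' e modn_small.
Qed.

Lemma semigroup_apery m i j :
  apery_pair n u v i j -> weight u v i j = m %[mod n] ->
  semigroup3 n u v m <-> weight u v i j <= m.
Proof.
move=> ap e; split.
  move=> [x [y [z em]]].
  have e' : weight u v y z = weight u v i j %[mod n].
    by rewrite e em -addnA modnMDl.
  have [k ek] := apery_weight_le ap e'.
  by move: ek; rewrite em /weight; clear; lia.
move=> le_m; have /eqP := e; rewrite eq_sym eqn_mod_dvd // => /dvdnP[k ek].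
by exists k, i, j; rewrite -addnA -/(weight u v i j) -ek subnK.
Qed.

Lemma gap_weight i j m :
  apery_pair n u v i j -> weight u v i j = m %[mod n] ->
  gaps n u v m <-> m < weight u v i j.
Proof.
move=> ap e; rewrite ltnNge; split.
  by move=> [_ /(semigroup_apery ap e) /negP].
move=> /negP nle; have nS : ~ semigroup3 n u v m.
  by move/(semigroup_apery ap e).
split=> //=; case: m {e nle} nS => // nS; case: nS.
by exists 0, 0, 0.
Qed.

Lemma apery_perm b c p q f :
  apery_transversal f ->
  (forall i j, apery_pair n u v i j <-> Lshape b c p q i j) ->
  perm_eq (codom f) (Lseq b c p q).
Proof.
move=> fP LP; apply: uniq_perm; last 1 first.
- move=> [i j]; rewrite mem_Lseq; apply/codomP/idP => [[r er]|/LP ap].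
    by have [] := fP r; rewrite -er => /LP.
  exists (Ordinal (ltn_pmod (weight u v i j) n_gt0)).
  set r := Ordinal _; have [ap' e] := fP r.
  have [-> ->] := apery_pair_uniq u_gt0 ap ap' (esym e).
  by case: (f r).
- apply/injectiveP => r r' e; apply: ord_inj.
  by have [_ <-] := fP r; have [_ <-] := fP r'; rewrite e.
- exact: Lseq_uniq.
Qed.

(** The gaps congruent to r are r, r + n, ..., up to the Apery element of the
    class, which is excluded. *)
Lemma gaps_perm f :
  apery_transversal f ->
  finite_set (gaps n u v) /\
  perm_eq (fset_set (gaps n u v))
    [seq r + n * t | r : 'I_n <- enum 'I_n,
                     t : nat <- iota 0 (weight u v (f r).1 (f r).2 %/ n)].
Proof.
move=> fP; set s := (X in perm_eq _ X).
have memP m : gaps n u v m <-> m \in s.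
  split=> [gm|].
    pose r := Ordinal (ltn_pmod m n_gt0).
    have [ap e] := fP r.
    have lt_m : m < weight u v (f r).1 (f r).2.
      have e' : weight u v (f r).1 (f r).2 = m %[mod n] by rewrite e.
      by apply/(gap_weight ap e').
    apply/allpairsPdep; exists r, (m %/ n).
    rewrite mem_enum mem_iota; split=> //.
      rewrite add0n /=; move: lt_m.
      rewrite {1}(divn_eq m n) {1}(divn_eq (weight u v (f r).1 (f r).2) n) e /=.
      by rewrite ltn_add2r ltn_pmul2r.
    by rewrite /= addnC mulnC -divn_eq.
  move=> /allpairsPdep[r [t [_ + ->]]]; rewrite mem_iota /= add0n => lt_t.
  have [ap e] := fP r.
  have lt_r := ltn_ord r.
  have e' : weight u v (f r).1 (f r).2 = r + n * t %[mod n].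
    by rewrite e addnC mulnC modnMDl modn_small.
  apply/(gap_weight ap e').
  rewrite (divn_eq (weight u v (f r).1 (f r).2) n) e.
  by move: lt_r lt_t; clear; nia.
have gapsE : gaps n u v = [set` s]%classic.
  by apply/seteqP; split=> m /memP.
have fin : finite_set (gaps n u v) by rewrite gapsE; apply: finite_seq.
split=> //; apply: uniq_perm.
- exact: fset_uniq.
- apply: allpairs_uniq_dep.
  - exact: enum_uniq.
  - by move=> r _; apply: iota_uniq.
  move=> [r t] [r' t'] _ _ /= e.
  have er : r = r'.
    apply: ord_inj; have := congr1 (modn^~ n) e.
    by rewrite !(mulnC n) !(addnC (nat_of_ord _)) !modnMDl !modn_small.
  subst r'; congr existT; apply/eqP.
  by move: e => /addnI /eqP; rewrite eqn_pmul2l.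
- move=> m; rewrite in_fset_set //; apply/idP/idP; rewrite inE => /memP //.
Qed.

End CountingGaps.

(** * Genus and Frobenius number *)

Section GenusAndFrobenius.
Variables (n u v : nat).
Hypotheses (n_gt0 : 0 < n) (u_gt0 : 0 < u) (v_gt0 : 0 < v).
Hypothesis gcd_nuv : gcdn (gcdn n u) v = 1.

Lemma finite_gaps : finite_set (gaps n u v).
Proof.
have [f fP] := apery_transversal_exists n_gt0 u_gt0 gcd_nuv.
by have [] := gaps_perm n_gt0 fP.
Qed.

Lemma gap_le_frobenius m : gaps n u v m -> m <= frobenius n u v.
Proof.
move=> gm; rewrite /frobenius; apply: (@leq_bigmax_seq _ _ xpredT id m) => //.
by rewrite in_fset_set ?inE //; apply: finite_gaps.
Qed.

(** If the Apery element w exceeds n, then w - n is a gap. *)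
Lemma apery_le_frobenius i j :
  apery_pair n u v i j -> weight u v i j <= frobenius n u v + n.
Proof.
move=> ap; have [le_n|lt_n] := leqP (weight u v i j) n; first lia.
rewrite addnC -leq_subLR; apply: gap_le_frobenius.
apply/(gap_weight ap); last lia.
by rewrite -{1}(subnK (ltnW lt_n)) modnDr.
Qed.

(** Selmer's formula: the class of r contains (w_r - r) / n gaps, where w_r is
    its Apery element. *)
Lemma genus_apery_sum b c p q :
  (forall i j, apery_pair n u v i j <-> Lshape b c p q i j) ->
  n * genus n u v + \sum_(r < n) r =
  \sum_(x <- Lseq b c p q) weight u v x.1 x.2.
Proof.
move=> LP; have [f fP] := apery_transversal_exists n_gt0 u_gt0 gcd_nuv.
have [_ permG] := gaps_perm n_gt0 fP.
rewrite -(perm_big _ (apery_perm n_gt0 u_gt0 fP LP)) /= big_map big_enum /=.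
have -> : genus n u v = size (fset_set (gaps n u v)) by [].
rewrite (perm_size permG) size_allpairs_dep sumnE big_map big_enum /=.
rewrite big_distrr -big_split /=; apply: eq_bigr => r _.
by rewrite size_iota {2}(divn_eq (weight u v _ _) n) (fP r).2 mulnC.
Qed.

(** The area of the L-shape is the number of residue classes. *)
Lemma size_apery b c p q :
  (forall i j, apery_pair n u v i j <-> Lshape b c p q i j) ->
  n = b * (q + c) + p * c.
Proof.
move=> LP; have [f fP] := apery_transversal_exists n_gt0 u_gt0 gcd_nuv.
have := perm_size (apery_perm n_gt0 u_gt0 fP LP).
by rewrite size_cat !size_rect size_map -cardE card_ord.
Qed.

(** Since n = (b + p)(q + c) - p q is the determinant of the two relations of
    the L-shape, Cramer's rule expresses u and v through the parameters. *)
Lemma Lshape_parameters : exists b c p q alpha beta,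
  let A := (alpha + beta) * (p + b) * (q + c) in
  let P := alpha * p * c in
  let Q := beta * b * q in
  let sigma := sigma1 n u v in
  [/\ n = b * (q + c) + p * c,
      u = alpha * (q + c) + beta * q /\ v = beta * (p + b) + alpha * p,
      0 < A,
      2 * genus n u v + sigma = A + P + Q + 1
    & A + P <= g3 n u v /\ A + Q <= g3 n u v].
Proof.
have [b [c [p [q [alpha [beta [b_gt0 c_gt0 eu ev LP]]]]]]] :=
  apery_pair_Lshape n_gt0 u_gt0 v_gt0.
have en := size_apery LP.
(* Eliminating v between the two relations; p q u is added on both sides to
   avoid a subtraction. *)
have eu' : u = alpha * (q + c) + beta * q.
  apply/eqP; rewrite -(eqn_pmul2r n_gt0) -(eqn_add2l (p * q * u)); apply/eqP.
  transitivity ((q + c) * ((b + p) * u)); first by rewrite en; ring.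
  rewrite eu mulnDr.
  transitivity (q * ((q + c) * v) + alpha * (q + c) * n); first by ring.
  rewrite ev; ring.
have ev' : v = beta * (p + b) + alpha * p.
  apply/eqP; rewrite -(eqn_pmul2r n_gt0) -(eqn_add2l (p * q * v)); apply/eqP.
  transitivity ((p + b) * ((q + c) * v)); first by rewrite en; ring.
  rewrite ev mulnDr.
  transitivity (p * ((b + p) * u) + beta * (p + b) * n); first by ring.
  rewrite eu; ring.
exists b, c, p, q, alpha, beta => A P Q sigma.
split=> //.
- rewrite /A !muln_gt0 !addn_gt0 b_gt0 c_gt0 !orbT !andbT -addn_gt0 lt0n.
  apply/eqP => /eqP; rewrite addn_eq0 => /andP[/eqP a0 /eqP b0].
  by move: u_gt0; rewrite eu' a0 b0.
- (* Both sides are multiplied by n, and the doubled sums of weights and of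
     residues are added so that their closed forms can be substituted. *)
  apply/eqP; rewrite -(eqn_pmul2l n_gt0); apply/eqP.
  have := genus_apery_sum LP; rewrite /Lseq big_cat /=.
  have := sum_rect u v 0 b (q + c); have := sum_rect u v b p c.
  have : 2 * (\sum_(r < n) r) + n = n * n.
    by rewrite -(big_mkord xpredT id) /index_iota subn0 sum_iota0.
  set s := \sum_(r < n) r; set s1 := \sum_(_ <- rect 0 _ _) _.
  set s2 := \sum_(_ <- rect b _ _) _; set G := genus n u v.
  move=> es es2 es1 esum.
  apply: (@addnI (2 * s + n + 2 * s2 + 2 * s1)).
  transitivity (2 * (n * G + s) + (2 * s2 + p * c * (u + v))
      + (2 * s1 + b * (q + c) * (u + v)) + n * n + n).
    have split_n : n * (u + v) = p * c * (u + v) + b * (q + c) * (u + v).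
      by rewrite {1}en; ring.
    transitivity (2 * s + n + 2 * s2 + 2 * s1
                  + 2 * n * G + n * n + n * (u + v)).
      by rewrite /sigma /sigma1; ring.
    by rewrite split_n; ring.
  rewrite esum es2 es1 es.
  rewrite /A /P /Q; move: s1 s2 {es es1 es2 esum} => s1 s2.
  transitivity (n * n + 2 * s1 + 2 * s2 +
    (p * c * ((2 * b + p) * u + c * v)
     + b * (q + c) * ((2 * 0 + b) * u + (q + c) * v) + n)); first by ring.
  transitivity (n * n + 2 * s1 + 2 * s2 +
    (n * (A + P + Q) + n)); last by rewrite /A /P /Q; ring.
  do 2 congr (_ + _).
  by rewrite eu' ev' en /A /P /Q; ring.
rewrite /g3 /sigma1.
(* The two outer corners of the L-shape. *)
have c1 : Lshape b c p q (b.-1 + p) c.-1 by rewrite /Lshape; lia.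
have c2 : Lshape b c p q b.-1 (q + c.-1) by rewrite /Lshape; lia.
have := apery_le_frobenius ((LP _ _).2 c1).
have := apery_le_frobenius ((LP _ _).2 c2).
have w1 : weight u v (b.-1 + p) c.-1 + u + v = A + P.
  rewrite /weight.
  transitivity ((b.-1.+1 + p) * u + c.-1.+1 * v); first by ring.
  by rewrite !prednK // eu' ev' /A /P; ring.
have w2 : weight u v b.-1 (q + c.-1) + u + v = A + Q.
  rewrite /weight.
  transitivity (b.-1.+1 * u + (q + c.-1.+1) * v); first by ring.
  by rewrite !prednK // eu' ev' /A /Q; ring.
rewrite -w1 -w2; clear; lia.
Qed.

Lemma semigroup3D x y :
  semigroup3 n u v x -> semigroup3 n u v y -> semigroup3 n u v (x + y).
Proof.
move=> [a [b [c ->]]] [a' [b' [c' ->]]].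
by exists (a + a'), (b + b'), (c + c'); ring.
Qed.

Lemma frobenius_gap m : gaps n u v m -> gaps n u v (frobenius n u v).
Proof.
move=> gm; set F := frobenius n u v.
have F_gt0 : 0 < F.
  by apply: leq_trans (gap_le_frobenius gm); case: gm.
have : F = 0 \/ F \in fset_set (gaps n u v).
  rewrite /F /frobenius big_seq.
  elim/big_ind: _ => [|x y [->|xs] [->|ys]|x xs]; rewrite ?max0n ?maxn0; auto.
  by right; case: (leqP x y).
case=> [F0|]; first by rewrite F0 in F_gt0.
by rewrite in_fset_set ?inE //; apply: finite_gaps.
Qed.

(** The map x |-> F - x sends elements of the semigroup in [0, F] to gaps, so
    the F + 1 integers of this interval are covered by the gaps and their
    reflections. *)
Lemma frobenius_lt_2genus m :
  gaps n u v m -> frobenius n u v < 2 * genus n u v.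
Proof.
move=> /frobenius_gap gF; set F := frobenius n u v in gF *.
pose s : seq nat := fset_set (gaps n u v).
have memP x : x \in s <-> gaps n u v x.
  by rewrite /s in_fset_set ?inE //; apply: finite_gaps.
have sub : {subset iota 0 F.+1 <= s ++ [seq F - x | x <- s]}.
  move=> x; rewrite mem_iota add0n ltnS mem_cat /= => le_x.
  apply/orP; have [xs|/negP xNs] := boolP (x \in s); [by left | right].
  apply/mapP; exists (F - x); last by rewrite subKn.
  have S0 : semigroup3 n u v 0 by exists 0, 0, 0.
  have xS : semigroup3 n u v x.
    apply: contrapT => xNS; apply/xNs/memP; split=> //=.
    by case: x {le_x xNs} xNS.
  apply/memP; split=> /=.
    rewrite subn_gt0 ltn_neqAle le_x andbT; apply/eqP => xF.
    by case: gF => _; rewrite -xF.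
  move=> FxS; case: gF => _; apply; rewrite -(subnK le_x).
  exact: semigroup3D.
have := uniq_leq_size (iota_uniq 0 F.+1) sub.
by rewrite size_iota size_cat size_map addnn -mul2n.
Qed.

End GenusAndFrobenius.

(** * The polynomial inequality *)

Lemma amgm x y P Q : x * y = P * Q -> Q <= P ->
  2 * Q <= x + y /\ (x + y = 2 * Q -> x = Q /\ y = Q).
Proof.
move=> exy leQP; have leQQ : Q * Q <= x * y by rewrite exy leq_mul2r leQP orbT.
have agm : 4 * (x * y) <= (x + y) * (x + y).
  by rewrite mulnA; have := (nat_AGM2 x y).1; rewrite mulnn; lia.
split; last by move=> e; nia.
rewrite leqNgt; apply/negP => lt_xy; nia.
Qed.

(** Besides P and Q, the expansion of A consists of three pairs of monomials of
    product P Q, each pair having sum at least 2 Q; hence A + P >= 2 P + 7 Q. In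
    the case of equality all eight monomials have the same value, which is
    positive, and cancelling common factors yields the conclusion. *)
Lemma nine_min_le alpha beta b c p q :
  let A := (alpha + beta) * (p + b) * (q + c) in
  let P := alpha * p * c in
  let Q := beta * b * q in
  Q <= P -> 9 * Q <= A + P /\
  (A + P = 9 * Q -> 0 < A -> [/\ alpha = beta, b = p & c = q]).
Proof.
move=> A P Q leQP.
have [l1 e1] := @amgm (alpha * p * q) (beta * b * c) P Q
  ltac:(rewrite /P /Q; ring) leQP.
have [l2 e2] := @amgm (alpha * b * q) (beta * p * c) P Q
  ltac:(rewrite /P /Q; ring) leQP.
have [l3 e3] := @amgm (alpha * b * c) (beta * p * q) P Q
  ltac:(rewrite /P /Q; ring) leQP.
have eA : A = P + Q + (alpha * p * q + beta * b * c)
    + (alpha * b * q + beta * p * c) + (alpha * b * c + beta * p * q).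
  by rewrite /A /P /Q; ring.
split; first by move: leQP l1 l2 l3 eA; clear; lia.
move=> eq9 A_gt0.
have [] : [/\ P = Q, 0 < Q, alpha * p * q + beta * b * c = 2 * Q,
   alpha * b * q + beta * p * c = 2 * Q
   & alpha * b * c + beta * p * q = 2 * Q].
  by move: A_gt0 leQP l1 l2 l3 eA eq9; clear; split; lia.
move=> eP Q_gt0 /e1[apq _] /e2[abq bpc] /e3[abc _].
have : 0 < alpha * b * q by rewrite abq.
rewrite !muln_gt0 => /andP[/andP[alpha_gt0 b_gt0] q_gt0].
have : 0 < beta * p * c by rewrite bpc.
rewrite !muln_gt0 => /andP[/andP[beta_gt0 p_gt0] c_gt0].
split.
- apply/eqP; rewrite -(eqn_pmul2r p_gt0) -(eqn_pmul2r c_gt0).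
  by rewrite bpc -eP.
- apply/eqP; rewrite -(eqn_pmul2l alpha_gt0) -(eqn_pmul2r q_gt0).
  by rewrite abq apq.
- apply/eqP; rewrite -(@eqn_pmul2l (alpha * b)) ?muln_gt0 ?alpha_gt0 //.
  by rewrite abc abq.
Qed.

(** Exchanging alpha with beta, b with p and c with q preserves A and exchanges
    P with Q, so [nine_min_le] covers both orderings of P and Q. *)
Lemma genus_frobenius_bound n u v : 0 < n -> 0 < u -> 0 < v ->
  gcdn (gcdn n u) v = 1 ->
  9 * (2 * genus n u v + sigma1 n u v) < 10 * g3 n u v + 9.
Proof.
move=> n_gt0 u_gt0 v_gt0 gcd1.
have [b [c [p [q [alpha [beta]]]]]] := Lshape_parameters n_gt0 u_gt0 v_gt0 gcd1.
move=> /= [en [eu ev] A_gt0 eG [g1 g2]].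
have noteq : ~ [/\ alpha = beta, b = p & c = q].
  case=> e1 e2 e3; subst alpha b c.
  have : 3 %| gcdn (gcdn n u) v.
    rewrite !dvdn_gcd; apply/andP; split; first (apply/andP; split).
    - by apply/dvdnP; exists (p * q); rewrite en; ring.
    - by apply/dvdnP; exists (beta * q); rewrite eu; ring.
    - by apply/dvdnP; exists (beta * p); rewrite ev; ring.
  by rewrite gcd1.
set A := (alpha + beta) * (p + b) * (q + c) in A_gt0 eG g1 g2.
set P := alpha * p * c in eG g1; set Q := beta * b * q in eG g2.
have [leQP|/ltnW lePQ] := leqP Q P.
  have [le9 eq9] := nine_min_le leQP.
  have lt9 : 9 * Q < A + P.
    rewrite ltn_neqAle le9 andbT; apply/eqP => e.
    by apply: noteq; apply: (eq9 (esym e)).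
  by move: lt9 eG g1; clear; lia.
have [] := @nine_min_le beta alpha p q b c lePQ.
rewrite (addnC beta) (addnC b) (addnC c) -/A -/P -/Q => le9 eq9.
have lt9 : 9 * P < A + Q.
  rewrite ltn_neqAle le9 andbT; apply/eqP => e.
  by apply: noteq; case: (eq9 (esym e) A_gt0).
by move: lt9 eG g2; clear; lia.
Qed.

(** * Bounds on the rescaled genus *)

Import GRing.Theory Num.Theory.
Local Open Scope ring_scope.

Theorem mainTheorem2 (d1 d2 d3 : nat)
  (hgcd : gcdn (gcdn d1 d2) d3 = 1%N)
  (h1 : (3 <= d1)%N) (h12 : (d1 < d2)%N) (h23 : (d2 < d3)%N)
  (h3 : (d3 <= d1 * d2 - d1 - d2)%N)
  (hmin1 : ~ lincomb2 d2 d3 d1)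
  (hmin2 : ~ lincomb2 d1 d3 d2)
  (hmin3 : ~ lincomb2 d1 d2 d3) :
  1 / 2 <= rescaled_genus d1 d2 d3 < 5 / 9.
Proof.
have d1_gt0 : (0 < d1)%N by lia.
have d2_gt0 : (0 < d2)%N by lia.
have d3_gt0 : (0 < d3)%N by lia.
have gap1 : gaps d1 d2 d3 1%N.
  split=> // -[[|a] [[|b] [[|c]]]]; lia.
have lower := frobenius_lt_2genus d1_gt0 d2_gt0 hgcd gap1.
have upper := genus_frobenius_bound d1_gt0 d2_gt0 d3_gt0 hgcd.
have g_gt0 : (0 < g3 d1 d2 d3)%N by rewrite /g3 /sigma1; lia.
rewrite /rescaled_genus /K0 /delta1 ler_pdivlMr ?ltr0n //.
rewrite ltr_pdivrMr ?ltr0n //.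
move: lower upper; rewrite -(ler_nat rat) -(ltr_nat rat) /g3.
rewrite !(natrD, natrM) -addn1 natrD => lower upper.
apply/andP; split; lra.
Qed.
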